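(* If $L$ is a nonempty partial groupoid, then $\deg(L) \leq \dim(L)+1$. In particular, a finite partial groupoid (i.e., one with finitely many edges, meaning $L_1$ is finite) has finite degree.
   Context: Let $\Upsilon$ be the category with objects $[n]=\{0,1,\dots,n\}$, $n\ge 0$, and all functions as morphisms. A symmetric set is a functor $X\colon\Upsilon^{\mathrm{op}}\to\mathsf{Set}$; write $X_n=X([n])$. Restricting to order-preserving maps gives its underlying simplicial set, with faces $d_i$. Let $\epsilon_{ij}\colon[1]\to[n]$ send $0\mapsto i$, $1\mapsto j$. A symmetric set $X$ is spiny if for all $n\ge1$ the map $X_n\to\prod_{i=1}^n X_1$, $x\mapsto(\epsilon_{01}^*x,\dots,\epsilon_{n-1,n}^*x)$, is injective. A partial groupoid is a spiny symmetric set. Dimension: for $n\ge-1$, the $n$-skeleton $\mathrm{sk}_nX$ is the smallest symmetric subset of $X$ containing $X_k$ for all $k\le n$. $X$ is $n$-skeletal if $X=\mathrm{sk}_nX$, and $\dim X=n$ if $X$ is $n$-skeletal but not $m$-skeletal for any $m<n$; $\dim X=\infty$ if $X$ is not $n$-skeletal for any $n$. Degree: $I\subset[n]$ is gapped if distinct elements of $I$ differ by at least $2$. For $k\ge1$, a simplicial set $X$ is lower $(2k-1)$-Segal if for every $n$ and every gapped $I\subset[n]$ of cardinality $k+1$, the cube $J\mapsto X_{[n]\setminus J}$ ($J\subseteq I$) is a limit diagram; i.e., for every family $(x_i)_{i\in I}$ in $X_{n-1}$ with $d_ix_j=d_{j-1}x_i$ for all $i<j$ in $I$, there is a unique $x\in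 X_n$ with $d_ix=x_i$ for all $i\in I$. A symmetric set is lower $(2k-1)$-Segal if its underlying simplicial set is. $\deg(X)$ is the least $k\ge1$ such that $X$ is lower $(2k-1)$-Segal, and $\infty$ if there is none. *)

(* Defs.v *)
From HB Require Import structures.
From mathcomp Require Import all_boot all_order all_algebra.
From mathcomp Require Import all_classical all_reals.

Set Implicit Arguments.
Unset Strict Implicit.
Unset Printing Implicit Defensive.

Import Order.TTheory GRing.Theory Num.Theory.

(* The object [n] = {0, ..., n} is 'I_n.+1; arbitrary maps are finfuns. *)
Definition umap (m n : nat) := {ffun 'I_m.+1 -> 'I_n.+1}.

Definition uid (n : nat) : umap n n := [ffun i => i].

Definition ucomp (l m n : nat) (g : umap m n) (f : umap l m) : umap l n :=
  [ffun i => g (f i)].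

Record symset : Type := Symset {
  symcar :> nat -> Type;
  symact : forall m n, umap m n -> symcar n -> symcar m;
  symact_id : forall n (x : symcar n), symact (uid n) x = x;
  symact_comp : forall l m n (g : umap m n) (f : umap l m) (x : symcar n),
    symact (ucomp g f) x = symact f (symact g x) }.

Arguments symact X {m n} f x : rename.

Definition monotone (m n : nat) (f : umap m n) : bool :=
  [forall i : 'I_m.+1, forall j : 'I_m.+1, (i <= j) ==> (f i <= f j)].

Definition dmap (m n : nat) := {f : umap m n | monotone f}.

Lemma uid_monotone (n : nat) : monotone (uid n).
Proof. by apply/forallP => i; apply/forallP => j; rewrite !ffunE implybb. Qed.

Lemma ucomp_monotone (l m n : nat) (g : dmap m n) (f : dmap l m) :
  monotone (ucomp (val g) (val f)).
Proof.
apply/forallP => i; apply/forallP => j; apply/implyP => ij; rewrite !ffunE.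
have /forallP/(_ (val f i))/forallP/(_ (val f j))/implyP := valP g; apply.
by have /forallP/(_ i)/forallP/(_ j)/implyP := valP f; apply.
Qed.

Definition did (n : nat) : dmap n n := exist _ (uid n) (uid_monotone n).

Definition dcomp (l m n : nat) (g : dmap m n) (f : dmap l m) : dmap l n :=
  exist _ (ucomp (val g) (val f)) (ucomp_monotone g f).

Record simpset : Type := Simpset {
  simpcar :> nat -> Type;
  simpact : forall m n, dmap m n -> simpcar n -> simpcar m;
  simpact_id : forall n (x : simpcar n), simpact (did n) x = x;
  simpact_comp : forall l m n (g : dmap m n) (f : dmap l m) (x : simpcar n),
    simpact (dcomp g f) x = simpact f (simpact g x) }.

Arguments simpact X {m n} f x : rename.

Definition underlying (X : symset) : simpset :=
  @Simpset X (fun m n (f : dmap m n) => symact X (val f))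
    (fun n => @symact_id X n)
    (fun l m n (g : dmap m n) (f : dmap l m) =>
       @symact_comp X l m n (val g) (val f)).

(* lift i is the increasing injection [n] -> [n+1] that misses i. *)
Definition coface_fun (n : nat) (i : 'I_n.+2) : umap n n.+1 :=
  [ffun j => lift i j].

Lemma coface_monotone (n : nat) (i : 'I_n.+2) : monotone (coface_fun i).
Proof.
apply/forallP => j; apply/forallP => k; apply/implyP => jk.
by rewrite !ffunE /= leq_bump2.
Qed.

Definition coface (n : nat) (i : 'I_n.+2) : dmap n n.+1 :=
  exist _ (coface_fun i) (coface_monotone i).

Definition face (X : simpset) (n : nat) (i : 'I_n.+2) : X n.+1 -> X n :=
  simpact X (coface i).

Definition eps (n : nat) (i j : 'I_n.+1) : umap 1 n :=
  [ffun k => if k == ord0 then i else j].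

Definition spine (X : symset) (n : nat) (x : X n) : 'I_n -> X 1 :=
  fun i => symact X (eps (inord i) (inord i.+1)) x.

Definition spiny (X : symset) : Prop :=
  forall n : nat, 1 <= n -> injective (@spine X n).

Definition partial_groupoid (X : symset) : Prop := spiny X.

Definition nonempty_symset (X : symset) : Prop := exists n : nat, inhabited (X n).

Definition finite_symset (X : symset) : Prop := finite_set [set: X 1]%classic.

Definition symsubset (X : symset) (S : forall k : nat, set (X k)) : Prop :=
  forall (m n : nat) (f : umap m n) (x : X n), S n x -> S m (symact X f x).

(* The smallest symmetric subset, as an intersection; n is an integer so as to
   allow n = -1. *)
Definition skeleton (X : symset) (n : int) (k : nat) : set (X k) :=
  fun x => forall S : forall k : nat, set (X k), symsubset S ->
    (forall (j : nat) (y : X j), (j%:Z <= n)%R -> S j y) -> S k x.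

Definition skeletal (X : symset) (n : int) : Prop :=
  forall k : nat, @skeleton X n k = [set: X k]%classic.

(* xget defaults to +oo when no integer satisfies the predicate. *)
Definition symdim (X : symset) : \bar int :=
  xget +oo%E [set d : \bar int | exists n : int,
    [/\ d = n%:E, (-1 <= n)%R, skeletal X n
      & forall m : int, (-1 <= m < n)%R -> ~ skeletal X m]]%classic.

Definition gapped (n : nat) (I : {set 'I_n.+1}) : Prop :=
  forall i j : 'I_n.+1, i \in I -> j \in I -> i < j -> i + 2 <= j.

(* lower_segal k X: the simplicial set X is lower (2k-1)-Segal, for k >= 1.
   Only the objects [n.+2] are considered, because a gapped subset with
   k + 1 >= 2 elements exists in none of the smaller ones.  The inord's only
   move the indices i < j of [n.+2] to the indices i, j - 1 of [n.+1]. *)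
Definition lower_segal (k : nat) (X : simpset) : Prop :=
  forall (n : nat) (I : {set 'I_n.+3}), gapped I -> #|I| = k.+1 ->
  forall x : {i : 'I_n.+3 | i \in I} -> X n.+1,
  (forall i j : {i : 'I_n.+3 | i \in I}, val i < val j ->
     face (inord (val i)) (x j) = face (inord (val j).-1) (x i)) ->
  exists! y : X n.+2, forall i : {i : 'I_n.+3 | i \in I},
    face (val i) y = x i.

Definition symdeg (X : symset) : \bar int :=
  xget +oo%E [set d : \bar int | exists k : nat,
    [/\ d = (k%:Z)%:E, 1 <= k, lower_segal k (underlying X)
      & forall m : nat, 1 <= m < k -> ~ lower_segal m (underlying X)]]%classic.

(* Main.v *)
(* In a spiny symmetric set, the edges out of any fixed vertex c determine a
   simplex, since the edge from p to q is a face of the triangle (p, c, q).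
   Let I be gapped with d + 2 elements in [m], where d is the dimension, and let
   (x_i) be a compatible family.  Choose i0 in I and c outside I.  As x_i0 is
   pulled back from a simplex of dimension at most d, two of the d + 2 vertices
   (I minus i0) and c are identified in x_i0; call them a and b with a in I.
   The filler is then the degeneracy of x_a that sends a to b: comparing the
   edges out of c shows that all its faces are the prescribed ones.  If there are
   N edges, a simplex of dimension at least N has two equal edges out of its
   vertex 0, so it is degenerate; hence the dimension is at most N. *)
Require Import Defs.
From HB Require Import structures.
From mathcomp Require Import all_boot all_order all_algebra.
From mathcomp Require Import all_classical all_reals.
From mathcomp Require Import zify.

Set Implicit Arguments.
Unset Strict Implicit.
Unset Printing Implicit Defensive.

Import Order.TTheory GRing.Theory Num.Theory.

Local Notation sface := (@face (underlying _) _).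

(* Inverse of [lift i]; the value at i itself is junk. *)
Definition drop_ord (n : nat) (i p : 'I_n.+2) : 'I_n.+1 :=
  odflt ord0 (unlift i p).

Lemma drop_ordK (n : nat) (i p : 'I_n.+2) : p != i -> lift i (drop_ord i p) = p.
Proof.
by rewrite /drop_ord => pi; case: unliftP pi => [j ->|->]; rewrite ?eqxx.
Qed.

Lemma drop_ord_lift (n : nat) (i : 'I_n.+2) (l : 'I_n.+1) :
  drop_ord i (lift i l) = l.
Proof. by rewrite /drop_ord liftK. Qed.

(* Followed by [lift a], this moves a to b and fixes every other vertex. *)
Definition merge (n : nat) (a b : 'I_n.+2) : umap n.+1 n :=
  [ffun l => drop_ord a (if l == a then b else l)].

Lemma ucomp_eps (m n : nat) (g : umap m n) (i j : 'I_m.+1) :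
  ucomp g (eps i j) = eps (g i) (g j).
Proof. by apply/ffunP => k; rewrite !ffunE; case: ifP. Qed.

Lemma symact_eps (X : symset) (m n : nat) (g : umap m n) (i j : 'I_m.+1)
    (x : X n) :
  symact X (eps i j) (symact X g x) = symact X (eps (g i) (g j)) x.
Proof. by rewrite -symact_comp ucomp_eps. Qed.

Lemma edge_sym (X : symset) (n : nat) (i j : 'I_n.+1) (x : X n) :
  symact X (eps j i) x =
  symact X (eps ord_max ord0) (symact X (eps i j) x).
Proof. by rewrite symact_eps !ffunE. Qed.

Lemma edge_face (X : symset) (n : nat) (i p q : 'I_n.+2) (y : X n.+1) :
  p != i -> q != i ->
  symact X (eps p q) y =
  symact X (eps (drop_ord i p) (drop_ord i q)) (sface i y).
Proof.
by move=> pi qi; rewrite /face /= symact_eps !ffunE !drop_ordK.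
Qed.

Lemma star_inj (X : symset) (n : nat) (c : 'I_n.+1) (x y : X n) :
  spiny X -> 0 < n ->
  (forall l, symact X (eps c l) x = symact X (eps c l) y) -> x = y.
Proof.
move=> sX n0 xy; apply: (sX n n0); apply/funext => i; rewrite /spine.
set p := inord i; set q := inord i.+1.
pose g : umap 2 n :=
  [ffun k : 'I_3 => if k == 0%N :> nat then p else if k == 1%N :> nat then c else q].
have -> : eps p q = ucomp g (eps ord0 ord_max) by rewrite ucomp_eps !ffunE.
rewrite !symact_comp; congr (symact X _ _).
(* The spine of the triangle (p, c, q) consists of the edge from p to c, which is the reverse of the
   edge from c to p, and the edge from c to q. *)
apply: (sX 2) => //; apply/funext => j; rewrite /spine !symact_eps !ffunE.
case: j => -[|[|//]] j2 /=; rewrite !inordK //=.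
by rewrite (edge_sym c p x) (edge_sym c p y) xy.
Qed.

(** Restrictions of simplices of dimension at most n are closed under the action, so they already
    form the smallest symmetric subset. *)
Lemma skeletonP (X : symset) (n : int) (k : nat) (x : X k) :
  skeleton n x <->
  exists (j : nat) (y : X j) (f : umap k j), (j%:Z <= n)%R /\ x = symact X f y.
Proof.
split=> [|[j [y [f [jn ->]]]] S sS nS]; last by apply: sS; apply: nS.
pose S m (z : X m) := exists (j : nat) (y : X j) (f : umap m j),
  (j%:Z <= n)%R /\ z = symact X f y.
move=> /(_ S); apply=> [m l f z [j [y [g [jn ->]]]]|j y jn].
  by exists j, y, (ucomp g f); rewrite symact_comp.
by exists j, y, (uid j); rewrite symact_id.
Qed.

Lemma gapped_ltn_pair (n : nat) (I : {set 'I_n.+1}) :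
  gapped I -> 1 < #|I| ->
  exists i j : 'I_n.+1, [/\ i \in I, j \in I & i + 2 <= j].
Proof.
move=> gI /card_gt1P[i [j [iI jI]]]; rewrite neq_ltn => /orP[ij|ij].
  by exists i, j; split=> //; apply: gI.
by exists j, i; split=> //; apply: gI.
Qed.

Lemma gapped_notin (n : nat) (I : {set 'I_n.+1}) :
  gapped I -> 1 < #|I| -> exists c, c \notin I.
Proof.
move=> gI /(gapped_ltn_pair gI)[i [j [iI jI ij]]].
have i1 : i.+1 < n.+1 by have := ltn_ord j; lia.
exists (Ordinal i1); apply/negP => cI.
by have := gI _ _ iI cI (leqnn _); rewrite /=; lia.
Qed.

(* Two elements of I are at distance at least 2, so every edge of the spine
   avoids one of them. *)
Lemma gapped_faces_inj (X : symset) (n : nat) (I : {set 'I_n.+2})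
    (y z : X n.+1) :
  spiny X -> gapped I -> 1 < #|I| ->
  (forall i, i \in I -> sface i y = sface i z) -> y = z.
Proof.
move=> sX gI /(gapped_ltn_pair gI)[i [j [iI jI ij]]] yz.
apply: (sX n.+1) => //; apply/funext => l; rewrite /spine.
have lv : (inord l : 'I_n.+2) = l :> nat by rewrite inordK // ltnW // ltnS.
have lv1 : (inord l.+1 : 'I_n.+2) = l.+1 :> nat by rewrite inordK // ltnS.
have [k [kI lk l1k]] : exists k,
    [/\ k \in I, (inord l : 'I_n.+2) != k & (inord l.+1 : 'I_n.+2) != k].
  have [il|il] := boolP ((inord l != i) && (inord l.+1 != i)).
    by case/andP: il; exists i.
  by exists j; split=> //; move: il; rewrite -!val_eqE /= lv lv1; lia.
by rewrite !(edge_face _ lk l1k) yz.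
Qed.

(* The edge of x from p to q, when the vertices of x are numbered by [n+1] minus
   i; junk if p or q is i. *)
Definition edge_away (X : symset) (n : nat) (i : 'I_n.+2) (x : X n)
    (p q : 'I_n.+2) : X 1 :=
  symact X (eps (drop_ord i p) (drop_ord i q)) x.

(** This is the simplicial identity for deleting i and j, read on vertices: a vertex p that survives
    both deletions gets the same number in either order. *)
Lemma drop_ord_exchange (n : nat) (i j p : 'I_n.+3) :
  i < j -> p != i -> p != j ->
  exists p' : 'I_n.+1, drop_ord j p = lift (inord i) p' /\
                       drop_ord i p = lift (inord j.-1) p'.
Proof.
move=> ij pi pj; have pin := drop_ordK pi; have pjn := drop_ordK pj.
have i0 := ltn_ord i; have j0 := ltn_ord j; have p0 := ltn_ord p.
move: pi pj; rewrite -!val_eqE /= => pi pj.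
(* The number of p after both deletions: p minus the count of deleted vertices below it. *)
have p'n : p - (i < p) - (j < p) < n.+1 by lia.
have := congr1 val pin; have := congr1 val pjn; rewrite /= /bump => ej ei.
by exists (Ordinal p'n); split; apply/val_inj;
  rewrite /= /bump inordK; lia.
Qed.

(** The edge lies in the face missing both i and j, which [xi] and [xj] share. *)
Lemma edge_away_compat (X : symset) (n : nat) (i j p q : 'I_n.+3)
    (xi xj : X n.+1) :
  i < j ->
  sface (inord i) xj = sface (inord j.-1) xi ->
  p != i -> p != j -> q != i -> q != j ->
  edge_away i xi p q = edge_away j xj p q.
Proof.
move=> ij ce pi pj qi qj; rewrite /edge_away.
have [p' [-> ->]] := drop_ord_exchange ij pi pj.
have [q' [-> ->]] := drop_ord_exchange ij qi qj.
have := congr1 (symact X (eps p' q')) ce.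
by rewrite /face /= !symact_eps !ffunE.
Qed.

Lemma pigeonhole_in (T U : finType) (A : {set T}) (f : T -> U) :
  #|U| < #|A| -> exists a b, [/\ a \in A, b \in A, a != b & f a = f b].
Proof.
move=> UA; have /dinjectivePn[a aA [b /andP[ba bA] fab]] : ~~ dinjectiveb f (mem A).
  apply/negP => /dinjectiveP fi.
  by have := max_card (mem (f @: A)); rewrite card_in_imset // leqNgt UA.
by exists a, b; rewrite eq_sym.
Qed.

Lemma skeletal_lower_segal (X : symset) (d : nat) :
  spiny X -> skeletal X d%:Z -> lower_segal d.+1 (underlying X).
Proof.
move=> sX skX n I gI cI x cx.
have I1 : 1 < #|I| by rewrite cI.
have [c cnI] := gapped_notin gI I1.
have cN i : i \in I -> c != i by move=> iI; apply: contraNneq cnI => ->.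
pose E (i : {i | i \in I}) := edge_away (X := X) (val i) (x i).
have EC i j p q : p != val i -> p != val j -> q != val i -> q != val j ->
    E i p q = E j p q.
  move=> pi pj qi qj; have [ij|ij|ij] := ltngtP (val i) (val j).
    exact: edge_away_compat ij (cx _ _ ij) _ _ _ _.
    by apply/esym; exact: edge_away_compat ij (cx _ _ ij) _ _ _ _.
  by rewrite (val_inj (val_inj ij)).
have /card_gt0P[i0 i0I] : 0 < #|I| by rewrite cI.
pose s0 : {i | i \in I} := exist _ i0 i0I.
have [a [b [aI ai0 bi0 ab Eab]]] : exists a b,
    [/\ a \in I, a != i0, b != i0, a != b & E s0 c a = E s0 c b].
  have /skeletonP[j [y [f [jd xf]]]] : skeleton d%:Z (x s0 : X n.+1).
    by rewrite skX.
  have cA : #|'I_j.+1| < #|c |: (I :\ i0)|.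
    rewrite cardsU1 !inE (negbTE cnI) andbF card_ord.
    by have := cardsD1 i0 I; rewrite i0I cI; lia.
  have [a [b [aA bA ab fab]]] :=
    pigeonhole_in (fun l => f (drop_ord i0 l)) cA.
  have Eab : E s0 c a = E s0 c b.
    by rewrite /E /edge_away xf !symact_eps fab.
  have ni0 l : l \in c |: (I :\ i0) -> l != i0.
    by rewrite !inE => /orP[/eqP->|/andP[] //]; exact: cN.
  (* Only c lies outside I, so at least one of a and b is in I; if a is not, they are swapped. *)
  have [aI|aI] := boolP (a \in I); first by exists a, b; split; rewrite ?ni0.
  exists b, a; split; rewrite ?ni0 // 1?eq_sym //.
  move: aA bA; rewrite !inE (negbTE aI) andbF orbF => /eqP ac.
  by rewrite -ac eq_sym (negbTE ab) => /andP[].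
pose sa : {i | i \in I} := exist _ a aI.
pose y : X n.+2 := symact X (merge a b) (x sa).
have fy i : sface (val i) y = x i.
  have ciN := cN _ (valP i).
  apply: (star_inj (c := drop_ord (val i) c) sX) => // l.
  rewrite /face /= !symact_eps !ffunE drop_ordK // (negbTE (cN _ aI)).
  have -> : symact X (eps (drop_ord (val i) c) l) (x i) = E i c (lift (val i) l).
    by rewrite /E /edge_away drop_ord_lift.
  have li : lift (val i) l != val i by rewrite eq_sym neq_lift.
  move: (lift (val i) l) li => {}l li.
  change (E sa c (if l == a then b else l) = E i c l).
  case: eqP => [la|/eqP la]; last by apply: EC => //; exact: cN.
  (* For l = a, [EC] carries the edge from [x i] to [x s0], where [Eab] replaces a by b, and then on
     to [x sa]. *)
  have <- : E s0 c l = E i c l by apply: EC => //; rewrite ?la //; exact: cN.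
  by rewrite la Eab; apply: EC; rewrite //= 1?eq_sym // eq_sym; exact: cN.
exists y; split=> // z fz.
apply: (gapped_faces_inj sX gI I1) => i iI.
by rewrite (fy (exist _ i iI)) (fz (exist _ i iI)).
Qed.

(** Merging a into b changes only one edge out of c, and replaces it by an equal one. *)
Lemma eq_edge_degenerate (X : symset) (n : nat) (x : X n.+1)
    (c a b : 'I_n.+2) :
  spiny X -> c != a -> a != b ->
  symact X (eps c a) x = symact X (eps c b) x ->
  x = symact X (merge a b) (sface a x).
Proof.
move=> sX ca ab Eab; apply: (star_inj (c := c) sX) => // l.
rewrite /face /= !symact_eps !ffunE (negbTE ca) drop_ordK //.
by case: eqP => [->|/eqP la]; rewrite drop_ordK // eq_sym.
Qed.

Lemma finite_skeletal (X : symset) :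
  spiny X -> finite_symset X -> exists N : nat, skeletal X N%:Z.
Proof.
move=> sX [N /card_set_bijP[g [gN gi _]]]; exists N => k.
have {}gN z : g z < N by have := gN z Logic.I.
have {}gi : injective g by move=> z w; apply: (gi z w); rewrite in_setT.
apply/seteqP; split=> // x _; apply/skeletonP.
elim: k x => [|k IH] x; first by exists 0, x, (uid 0); rewrite symact_id.
have [kN|Nk] := leqP k.+1 N; first by exists k.+1, x, (uid _); rewrite symact_id.
have kN : #|'I_N| < #|[set: 'I_k.+2]| by rewrite cardsT !card_ord ltnS ltnW.
have [a [b [_ _ ab /(congr1 val)/gi Eab]]] :=
  pigeonhole_in (fun l => Ordinal (gN (symact X (eps ord0 l) x))) kN.
(* The vertex to be deleted must not be the base vertex 0; a and b are distinct, so one of them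
   qualifies. *)
wlog a0 : a b ab Eab / a != ord0 => [wl|].
  have [a0|] := eqVneq a ord0; last exact: (wl a b).
  by apply: (wl b a); rewrite // -?a0 eq_sym.
rewrite eq_sym in a0; rewrite (eq_edge_degenerate sX a0 ab Eab).
have [j [y [f [jN ->]]]] := IH (sface a x).
by exists j, y, (ucomp f (merge a b)); rewrite symact_comp.
Qed.

Lemma lower_segal_symdeg (X : symset) (k : nat) :
  0 < k -> lower_segal k (underlying X) -> (symdeg X <= (k%:Z)%:E)%E.
Proof.
move=> k0 sk; pose P m := `[< 0 < m /\ lower_segal m (underlying X) >].
have exP : exists m, P m by exists k; apply/asboolP.
case: (ex_minnP exP) => m /asboolP[m0 sm] mmin.
rewrite /symdeg; case: xgetP => [d _ [j [-> j1 _ jmin]]|/(_ (m%:Z)%:E)[]].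
  by rewrite lee_fin lez_nat leqNgt; apply/negP => kj; apply: (jmin k); rewrite ?k0.
(* The minimal m belongs to the set defining [symdeg], so the default +oo does not occur. *)
exists m; split=> // l /andP[l0 lm] sl.
by move: lm; rewrite ltnNge mmin //; apply/asboolP.
Qed.

Theorem theorem1p4 :
  (forall L : symset, partial_groupoid L -> nonempty_symset L ->
     (symdeg L <= symdim L + 1)%E)
  /\
  (forall L : symset, partial_groupoid L -> finite_symset L ->
     (symdeg L < +oo)%E).
Proof.
split=> L sL.
  move=> [k [x]]; rewrite /symdim.
  case: xgetP => [_ _ [n [-> _ skn _]]|_]; last by rewrite addye// leey.
  (* The given simplex comes from some dimension j with 0 <= j <= n, which rules out n = -1. *)
  have /skeletonP[j [_ [_ [jn _]]]] : skeleton n x by rewrite skn.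
  case: n skn jn => [n|//] skn _.
  have := lower_segal_symdeg (ltn0Sn n) (skeletal_lower_segal sL skn).
  by rewrite -EFinD -addn1 PoszD.
move=> /(finite_skeletal sL)[N /(skeletal_lower_segal sL) sN].
exact: le_lt_trans (lower_segal_symdeg (ltn0Sn N) sN) (ltry _).
Qed.
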